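(* Let $\mathcal{M}$ be a type $\mathrm{I}_\infty$ or type $\mathrm{II}_\infty$ factor. Then there always exists a (unital) von Neumann subalgebra $\mathcal{B}\subseteq\mathcal{M}$ that is regular in $\mathcal{M}$ but not unitarily regular in $\mathcal{M}$.
   Context: For a unital inclusion of von Neumann algebras $\mathcal{B}\subseteq\mathcal{M}$ (i.e. $1_{\mathcal{B}}=1_{\mathcal{M}}$), put $\mathcal{N}_{\mathcal{M}}(\mathcal{B})=\{n\in\mathcal{M}: n\mathcal{B}n^*\cup n^*\mathcal{B}n\subseteq\mathcal{B}\}$ (the normaliser) and $\mathcal{UN}_{\mathcal{M}}(\mathcal{B})=\{u\in\mathcal{M}\text{ unitary}: u\mathcal{B}u^*=\mathcal{B}\}$ (the unitary normaliser). $W^*(S)$ denotes the von Neumann subalgebra of $\mathcal{M}$ generated by $S$. $\mathcal{B}$ is regular in $\mathcal{M}$ if $W^*(\mathcal{N}_{\mathcal{M}}(\mathcal{B}))=\mathcal{M}$ and unitarily regular in $\mathcal{M}$ if $W^*(\mathcal{UN}_{\mathcal{M}}(\mathcal{B}))=\mathcal{M}$. *)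

(* Defs.v *)
From mathcomp Require Import all_boot all_order all_algebra sesquilinear.
From mathcomp Require Import complex.
From mathcomp Require Import all_classical all_reals all_analysis.

Set Implicit Arguments.
Unset Strict Implicit.
Unset Printing Implicit Defensive.

Import Order.TTheory GRing.Theory Num.Theory.
Import numFieldNormedType.Exports.

Local Open Scope classical_set_scope.
Local Open Scope ring_scope.
Local Open Scope complex_scope.

(* The inner product is linear in its first argument. *)
Record hilbertType (R : realType) := HilbertType {
  hcarrier :> completeNormedModType R[i];
  dotH : {dot hcarrier for (@Num.conj R[i])};
  dotH_norm : forall x : hcarrier, `|x| ^+ 2 = dotH x x }.

Section Operators.
Variables (R : realType) (H : hilbertType R).

(* Operators are plain functions H -> H, those in B(H) being singled out by
   the predicate bounded_operator.  In particular, equality of operators is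
   equality of functions and the product is composition. *)
Definition bounded_operator : set (H -> H) :=
  [set T | linear T /\ exists C : R, forall x, `|T x| <= C%:C * `|x|].

Definition is_adjoint (T S : H -> H) : Prop :=
  forall x y, dotH H (T x) y = dotH H x (S y).

(* The default value 0 is never used when T is bounded, an adjoint then existing
   by the Riesz representation theorem. *)
Definition adjoint (T : H -> H) : H -> H :=
  xget (fun=> 0) [set S | is_adjoint T S].

Lemma is_adjoint_unique T S S' : is_adjoint T S -> is_adjoint T S' -> S = S'.
Proof.
move=> TS TS'; apply/funext => y; apply/eqP; rewrite -subr_eq0 -normr_eq0.
have /eqP : `|S y - S' y| ^+ 2 = 0 by rewrite dotH_norm linearBr /= -TS TS' subrr.
by rewrite expf_eq0.
Qed.

Lemma adjointE T S : is_adjoint T S -> adjoint T = S.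
Proof.
move=> TS; rewrite /adjoint; case: xgetP => [S' _ TS'|/(_ S)//].
exact: is_adjoint_unique TS' TS.
Qed.

Definition commutant (S : set (H -> H)) : set (H -> H) :=
  [set T | bounded_operator T /\ forall s, S s -> T \o s = s \o T].

(* A set that is its own bicommutant automatically consists of bounded
   operators, contains the identity of H and is an algebra. *)
Definition von_neumann (M : set (H -> H)) : Prop :=
  (forall T, M T -> M (adjoint T)) /\ commutant (commutant M) = M.

(* The intersection of the von Neumann subalgebras of M containing S; all of
   them share the unit idfun of M. *)
Definition vn_generated (M S : set (H -> H)) : set (H -> H) :=
  [set T | forall N, von_neumann N -> N `<=` M -> S `<=` N -> N T].

Definition center (M : set (H -> H)) : set (H -> H) := M `&` commutant M.

(* The second condition excludes the zero algebra, acting on H = 0. *)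
Definition factor (M : set (H -> H)) : Prop :=
  [/\ von_neumann M, (idfun : H -> H) <> (fun=> 0)
    & center M = [set T | exists c : R[i], T = (fun x => c *: x)]].

Definition projection_in (M : set (H -> H)) : set (H -> H) :=
  [set p | [/\ M p, p \o p = p & adjoint p = p]].

Definition central_projection (M : set (H -> H)) : set (H -> H) :=
  projection_in M `&` center M.

Definition nonzero : set (H -> H) := [set p | p <> (fun=> 0)].

(* The order on projections: q is below p. *)
Definition subprojection (q p : H -> H) : Prop := p \o q = q.

Definition mvn_equiv (M : set (H -> H)) (p q : H -> H) : Prop :=
  exists v, [/\ M v, adjoint v \o v = p & v \o adjoint v = q].

Definition abelian_projection (M : set (H -> H)) : set (H -> H) :=
  [set p | projection_in M p /\ forall x y, M x -> M y ->
     (p \o x \o p) \o (p \o y \o p) = (p \o y \o p) \o (p \o x \o p)].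

Definition finite_projection (M : set (H -> H)) : set (H -> H) :=
  [set p | projection_in M p /\ forall q, projection_in M q ->
     subprojection q p -> mvn_equiv M p q -> q = p].

Definition type_I (M : set (H -> H)) : Prop :=
  forall z, central_projection M z -> nonzero z ->
    exists p, [/\ abelian_projection M p, nonzero p & subprojection p z].

Definition type_II (M : set (H -> H)) : Prop :=
  (forall p, abelian_projection M p -> ~ nonzero p) /\
  forall z, central_projection M z -> nonzero z ->
    exists p, [/\ finite_projection M p, nonzero p & subprojection p z].

Definition properly_infinite (M : set (H -> H)) : Prop :=
  forall z, central_projection M z -> nonzero z -> ~ finite_projection M z.

Definition type_I_infty_factor (M : set (H -> H)) : Prop :=
  [/\ factor M, type_I M & properly_infinite M].

Definition type_II_infty_factor (M : set (H -> H)) : Prop :=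
  [/\ factor M, type_II M & properly_infinite M].

Definition normaliser (M B : set (H -> H)) : set (H -> H) :=
  [set n | M n /\ forall b, B b ->
     B (n \o b \o adjoint n) /\ B (adjoint n \o b \o n)].

Definition unitary_normaliser (M B : set (H -> H)) : set (H -> H) :=
  [set u | [/\ M u, adjoint u \o u = idfun, u \o adjoint u = idfun
             & [set u \o b \o adjoint u | b in B] = B]].

Definition regular (M B : set (H -> H)) : Prop :=
  vn_generated M (normaliser M B) = M.

Definition unitarily_regular (M B : set (H -> H)) : Prop :=
  vn_generated M (unitary_normaliser M B) = M.

End Operators.

(* Main.v *)
Require Import Defs.
From mathcomp Require Import all_boot all_order all_algebra.
From mathcomp Require Import all_classical all_reals all_analysis.
From mathcomp Require Import sesquilinear complex ring lra.

Set Implicit Arguments.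
Unset Strict Implicit.
Unset Printing Implicit Defensive.

Import Order.TTheory GRing.Theory Num.Theory.
Import numFieldNormedType.Exports.

Local Open Scope classical_set_scope.
Local Open Scope complex_scope.
Local Open Scope ring_scope.

(** Let [p] be a projection of [M], different from [0] and [1], and let [B] be
    the block-diagonal algebra [p M p + (1 - p) M (1 - p)], which is the relative
    commutant of [p] in [M].

    [B] is always regular.  Write an element [T] of [M] as the sum of its four
    corners [p T p], [p T (1 - p)], [(1 - p) T p], [(1 - p) T (1 - p)].  Each corner
    [n] satisfies [n M n^* `<=` B] and [n^* M n `<=` B], because [n M n^*] and
    [n^* M n] live in a single diagonal block; so each corner normalises [B]
    ([normaliser_block], [regular_block_diagonal]).

    Unitary normalisers are much more rigid when [M] is a factor.  If [u] is one,
    then [q = u p u^*] commutes with [B].  A factor is a prime ring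
    ([factor_prime]), hence [q p] is [0] or [p] and [q (1 - p)] is [0] or [1 - p]
    ([commuting_block_trivial]).  Thus [q] is one of [0], [p], [1 - p], [1], where
    [0] and [1] are impossible.  If moreover no unitary of [M] conjugates [p] to
    [1 - p], then [q = p], that is, [u] is in [B].  All unitary normalisers then
    generate at most [B], which is not [M] because [p] is not central.

    It remains to find [p] that cannot be exchanged with its complement by a
    unitary of [M], and this is where the infinite type enters
    ([exists_unexchangeable_projection]).  There are a non-unitary isometry [v] in
    [M], since [1] is infinite, and a nonzero finite projection [p0].  Either
    [e = 1 - v v^*] has the required property, or [e] is equivalent to
    [v v^*], hence to [1]; then [v p0 v^*] has it, for otherwise [e], which is
    below [1 - v p0 v^*], would be equivalent to a subprojection of the finite
    projection [p0], and [1] would be finite.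

    The analytic input is the orthogonal projection onto a closed subspace.  It
    gives adjoints (Riesz), and it gives the central projection from which
    primeness of a factor follows. *)

(** * Hilbert spaces: orthogonal projections and adjoints *)

Section HilbertSpace.
Variables (R : realType) (H : hilbertType R).
Implicit Types (x y z w : H) (a : R[i]).

Local Notation "''[' x , y ]" := (dotH H x y) : ring_scope.

Lemma dotC x y : '[x, y] = ('[y, x])^*.
Proof. by rewrite hermC /= mul1r. Qed.

Lemma dotZl a x y : '[a *: x, y] = a * '[x, y].
Proof. by rewrite linearZl_LR. Qed.

Lemma dotZr a x y : '[x, a *: y] = a^* * '[x, y].
Proof. by rewrite linearZr_LR. Qed.

Lemma dot_eq0 x : ('[x, x] == 0) = (x == 0).
Proof. exact: dnorm_eq0. Qed.

Lemma complex_ge0E a : 0 <= a -> a = (complex.Re a)%:C.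
Proof. by move=> a0; rewrite RRe_real ?ger0_real. Qed.

(** The minimum over [t] of the quadratic [|w - t z|^2] is
    [|w|^2 - |'[w, z]|^2 / |z|^2]; with [d = 0] this is the Cauchy-Schwarz
    inequality, and with [w] almost minimal in a coset of a subspace it bounds
    the angle between [w] and that subspace. *)
Lemma dot_le_dist (d : R[i]) w z : (forall t, d <= `|w - t *: z| ^+ 2) ->
  `|'[w, z]| ^+ 2 <= (`|w| ^+ 2 - d) * `|z| ^+ 2.
Proof.
move=> dle; have [->|z0] := eqVneq z 0.
  by rewrite linear0r !normr0 expr0n /= mulr0.
have zz0 : 0 < '[z, z] by rewrite dnorm_gt0.
have := dle ('[w, z] / '[z, z]).
rewrite !dotH_norm (dnormB (dotH H)) dnormZ dotZr.
set n := _ + (_ * _); set q := _ + _^*.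
have -> : n - q = '[w, w] - `|'[w, z]| ^+ 2 / '[z, z].
  have zzc : ('[z, z])^* = '[z, z] by rewrite -dotC.
  rewrite {}/n {}/q !(rmorphM, fmorphV) /= !conjCK !zzc.
  rewrite normrM normfV (gtr0_norm zz0) expr_div_n (normCK '[w, z]) -!(dotC z w).
  have zzn : '[z, z] != 0 by rewrite gt_eqF.
  by field.
by rewrite lerBrDr addrC -lerBrDr ler_pdivrMr.
Qed.

Lemma cauchy_schwarz x y : `|'[x, y]| <= `|x| * `|y|.
Proof.
rewrite -(@ler_pXn2r _ 2) ?nnegrE ?mulr_ge0 // exprMn.
have /dot_le_dist : forall t, 0 <= `|x - t *: y| ^+ 2.
  by move=> t; rewrite exprn_ge0.
by rewrite subr0.
Qed.

Lemma parallelogram x y :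
  `|x + y| ^+ 2 + `|x - y| ^+ 2 = 2 * `|x| ^+ 2 + 2 * `|y| ^+ 2.
Proof. by rewrite !dotH_norm (dnormD (dotH H)) (dnormB (dotH H)) /=; ring. Qed.

Definition subspace (K : set H) :=
  K 0 /\ forall a x y, K x -> K y -> K (a *: x + y).

(** A filter of almost nearest points of [K] is Cauchy by the parallelogram
    law, and its limit is the foot of the perpendicular. *)
Lemma exists_orthogonal_projection (K : set H) x : subspace K -> closed K ->
  exists2 y, K y & forall z, K z -> '[x - y, z] = 0.
Proof.
move=> [K0 KZ] Kcl.
have KD u v : K u -> K v -> K (u + v).
  by move=> Ku /(KZ 1 _ _ Ku); rewrite scale1r.
have KS a u : K u -> K (a *: u).
  by move=> Ku; rewrite -[_ *: _]addr0; apply: KZ.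
(* The norm takes its values in [R[i]], whereas infima exist in [R]. *)
pose dist y : R := complex.Re (`|x - y| ^+ 2).
have distE y : `|x - y| ^+ 2 = (dist y)%:C.
  by apply: complex_ge0E; rewrite exprn_ge0.
have dist_ge0 y : 0 <= dist y by rewrite -lecR -distE exprn_ge0.
pose D := inf [set dist y | y in K].
have lbD : has_lbound [set dist y | y in K] by exists 0 => _ [y _ <-].
have Dle y : K y -> D%:C <= `|x - y| ^+ 2.
  by move=> Ky; rewrite distE lecR; apply: ge_inf => //; exists y.
pose near e : set H := [set y | K y /\ dist y < D + e].
pose F := filter_from [set e : R | 0 < e] near.
have FF : ProperFilter F.
  apply: filter_from_proper.
    apply: filter_from_filter; first by exists 1 => /=.
    move=> e f /= e0 f0; exists (Order.min e f); first by rewrite /= lt_min e0.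
    by move=> y [Ky]; rewrite -ltrBlDl lt_min !ltrBlDl => /andP[].
  move=> e /= e0.
  have [|_ [y Ky <-] lt] := @inf_adherent _ [set dist y | y in K] e e0.
    by split=> //; exists (dist 0); exists 0.
  by exists y; split.
(* Two almost nearest points are close, their midpoint being in [K]. *)
have near_close e y z : near e y -> near e z -> `|y - z| ^+ 2 <= (4 * e)%:C.
  move=> [Ky ye] [Kz ze].
  have -> : y - z = (x - z) - (x - y) by rewrite opprB [RHS]addrC addrA subrK.
  have sumE : (x - z) + (x - y) = (2 : R[i]) *: (x - (2^-1 : R[i]) *: (y + z)).
    rewrite scalerBr scalerA divff ?pnatr_eq0 // scale1r scaler_nat mulr2n opprD.
    by rewrite addrACA [- z - y]addrC.
  have := parallelogram (x - z) (x - y).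
  move/(canRL (addKr _)) => ->; rewrite sumE normrZ exprMn.
  have := Dle _ (KS 2^-1 _ (KD _ _ Ky Kz)); rewrite normr_nat !distE.
  rewrite -!(rmorph_nat (real_complex R)) -!(rmorphXn, rmorphM, rmorphN, rmorphD).
  rewrite !lecR; nra.
have : cvg F.
  apply/cauchy_cvgP/cauchy_exP => e e0.
  have eE := complex_ge0E (ltW e0); set r := complex.Re e in eE.
  have r0 : 0 < r by rewrite -ltcR -eE.
  have e'0 : 0 < r ^+ 2 / 8 by rewrite divr_gt0 ?exprn_gt0.
  have [y yn] : near (r ^+ 2 / 8) !=set0.
    by apply: (@filter_ex _ F); exists (r ^+ 2 / 8).
  exists y; exists (r ^+ 2 / 8) => // z zn; rewrite -ball_normE /=.
  rewrite -(@ltr_pXn2r _ 2) ?nnegrE ?(ltW e0) //.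
  apply: le_lt_trans (near_close _ _ _ yn zn) _.
  by rewrite eE -rmorphXn ltcR; nra.
move=> /cvg_ex [l Fl]; exists l.
  apply: (@closed_cvg _ _ F FF id K Kcl) => //.
  by exists 1 => //= y [].
move=> z Kz.
(* An almost nearest point [y] is almost a foot of the perpendicular, and [l] is
   close to such a [y]. *)
have small (e : R) : 0 < e -> `|'[x - l, z]| <= (2 * e)%:C * `|z|.
  move=> e0; have e0C : 0 <= e%:C by rewrite lecR ltW.
  have [y [[Ky yD] ly]] : (near (e ^+ 2) `&` ball l e%:C) !=set0.
    apply: (@filter_ex _ F); apply: filterI; last first.
      by apply: Fl; apply: nbhsx_ballx; rewrite ltcR.
    by exists (e ^+ 2) => //=; apply: exprn_gt0.
  have -> : x - l = (x - y) - (l - y) by rewrite opprB addrA subrK.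
  rewrite linearBl /=; apply: le_trans (ler_normB _ _) _.
  have -> : (2 * e)%:C * `|z| = e%:C * `|z| + e%:C * `|z|.
    by rewrite mulr_natl rmorphMn -mulrDl -mulr2n.
  apply: lerD.
    rewrite -(@ler_pXn2r _ 2) ?nnegrE ?mulr_ge0 //.
    have /dot_le_dist/le_trans : forall t, D%:C <= `|(x - y) - t *: z| ^+ 2.
      by move=> t; rewrite -addrA -opprD; apply: Dle; apply: KD => //; apply: KS.
    apply; rewrite exprMn ler_wpM2r ?exprn_ge0 // distE -rmorphXn -rmorphB lecR.
    by rewrite lerBlDl ltW.
  apply: le_trans (cauchy_schwarz _ _) _; rewrite ler_wpM2r //.
  by move: ly; rewrite -ball_normE /= => /ltW.
apply/eqP; rewrite -normr_le0.
have := @complex_ge0E `|z| (normr_ge0 _); set r := complex.Re _ => zE.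
have := @complex_ge0E `|'[x - l, z]| (normr_ge0 _); set s := complex.Re _ => sE.
have r0 : 0 <= r by rewrite -ler0c -zE normr_ge0.
rewrite sE lecR; apply/ler_addgt0Pr => e e0; rewrite add0r.
have := small (e / (2 * (r + 1))); rewrite sE zE -rmorphM lecR.
have r1 : 0 < 2 * (r + 1) by lra.
move=> /(_ (divr_gt0 e0 r1))/le_trans; apply.
rewrite mulrA mulrAC ler_pdivrMr //; nra.
Qed.


Lemma dot_inj x y : (forall z, '[z, x] = '[z, y]) -> x = y.
Proof.
by move=> xy; apply/eqP; rewrite -subr_eq0 -dot_eq0 linearBr /= xy subrr.
Qed.

Section LinearMaps.
Variables (V : normedModType R[i]) (f : H -> V).
Hypothesis f_linear : forall a x y, f (a *: x + y) = a *: f x + f y.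

Lemma lin0 : f 0 = 0.
Proof.
have := f_linear 1 0 0; rewrite !scale1r addr0 => /eqP.
by rewrite -subr_eq0 opprD addNKr oppr_eq0 => /eqP.
Qed.

Lemma linZ a x : f (a *: x) = a *: f x.
Proof. by rewrite -[a *: x]addr0 f_linear lin0 addr0. Qed.

Lemma linD x y : f (x + y) = f x + f y.
Proof. by rewrite -[x]scale1r f_linear !scale1r. Qed.

Lemma linB x y : f (x - y) = f x - f y.
Proof. by rewrite linD -scaleN1r linZ scaleN1r. Qed.

Lemma closed_kernel (C : R) : (forall x, `|f x| <= C%:C * `|x|) ->
  closed [set x | f x = 0].
Proof.
move=> fC x xcl /=; apply/eqP; rewrite -normr_le0.
pose D := `|C| + 1; have D0 : 0 < D by rewrite ltr_wpDl.
have fD y : `|f y| <= D%:C * `|y|.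
  apply: le_trans (fC y) _; rewrite ler_wpM2r // lecR.
  by rewrite (le_trans (ler_norm C)) // lerDl.
rewrite (complex_ge0E (normr_ge0 (f x))) lecR.
apply/ler_addgt0Pr => e e0; rewrite add0r.
have eD0 : 0 < (e / D)%:C by rewrite ltcR divr_gt0.
have [z [/= fz xz]] := xcl _ (nbhsx_ballx x _ eD0).
have : `|f x| <= D%:C * (e / D)%:C.
  rewrite -[f x]subr0 -fz -linB; apply: le_trans (fD _) _.
  rewrite ler_wpM2l ?lecR ?(ltW D0) //.
  by move: xz; rewrite -ball_normE => /ltW.
rewrite -rmorphM mulrC divfK ?gt_eqF //.
by rewrite (complex_ge0E (normr_ge0 (f x))) lecR.
Qed.

End LinearMaps.

Lemma subspace_kernel (V : normedModType R[i]) (f : H -> V) :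
  (forall a x y, f (a *: x + y) = a *: f x + f y) -> subspace [set x | f x = 0].
Proof.
move=> fl; split=> [|a x y /= fx fy]; first exact: lin0.
by rewrite fl fx fy scaler0 addr0.
Qed.

(** Riesz representation: a vector orthogonal to the kernel of the functional
    [x |-> '[T x, y]] represents it, up to a scalar. *)
Lemma exists_adjoint_at (T : H -> H) y : bounded_operator T ->
  exists z, forall x, '[T x, y] = '[x, z].
Proof.
move=> [Tl [C TC]]; pose f x : R[i]^o := '[T x, y].
have fl a u v : f (a *: u + v) = a *: f u + f v.
  by rewrite /f Tl linearPl.
have fC x : `|f x| <= (C * complex.Re `|y|)%:C * `|x|.
  apply: le_trans (cauchy_schwarz _ _) _.
  rewrite rmorphM /= -(complex_ge0E (normr_ge0 y)) mulrAC.
  by rewrite ler_wpM2r.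
have [f0|/existsNP [x0 fx0]] := pselect (forall x, f x = 0).
  by exists 0 => x; rewrite linear0r; apply: f0.
have [k fk korth] :=
  exists_orthogonal_projection x0 (subspace_kernel fl) (closed_kernel fl fC).
set w := x0 - k in korth.
have fw : f w != 0 by rewrite /w linB // fk subr0; apply/eqP.
have ww0 : '[w, w] != 0.
  rewrite dot_eq0; apply: contra fw => /eqP ->; rewrite lin0 //.
exists ((f w / '[w, w])^* *: w) => x.
rewrite dotZr conjCK.
have : '[w, x - (f x / f w) *: w] = 0.
  by apply: korth; rewrite /= linB // linZ // /GRing.scale /= divfK // subrr.
rewrite dotC linearBl /= dotZl => /(canRL conjCK)/eqP.
rewrite conjC0 subr_eq0 => /eqP ->; rewrite -/(f x).
by field; apply/andP.
Qed.

Implicit Types (S T : H -> H).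

Lemma adjointP T : bounded_operator T -> is_adjoint T (adjoint T).
Proof.
move=> bT; have /choice [S TS] := fun y => exists_adjoint_at y bT.
by rewrite (@adjointE _ _ T S) // => x y; apply: TS.
Qed.

Lemma is_adjoint_sym S T : is_adjoint T S -> is_adjoint S T.
Proof. by move=> TS x y; rewrite dotC -TS -dotC. Qed.

Lemma bounded_adjoint T : bounded_operator T -> bounded_operator (adjoint T).
Proof.
move=> bT; have TS := adjointP bT; set S := adjoint T in TS *.
have [_ [C TC]] := bT; split.
  move=> a x y; apply: dot_inj => z.
  by rewrite linearPr /= -!TS linearPr.
exists C => y; have [Sy0|Sy0] := eqVneq (S y) 0.
  rewrite Sy0 normr0; have [->|y0] := eqVneq y 0; first by rewrite normr0 mulr0.
  rewrite mulr_ge0 // -(@pmulr_lge0 _ `|y|) ?normr_gt0 //.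
  exact: le_trans (TC y).
rewrite -(@ler_pM2r _ `|S y|) ?normr_gt0 // -expr2 dotH_norm -TS.
apply: le_trans (real_ler_norm _) _.
  by rewrite TS -dotH_norm realX // normr_real.
apply: le_trans (cauchy_schwarz _ _) _.
by rewrite mulrAC ler_wpM2r.
Qed.

Lemma adjointK T : bounded_operator T -> adjoint (adjoint T) = T.
Proof. by move=> bT; apply/adjointE/is_adjoint_sym/adjointP. Qed.

Lemma adjoint_comp S T : bounded_operator S -> bounded_operator T ->
  adjoint (S \o T) = adjoint T \o adjoint S.
Proof. by move=> bS bT; apply: adjointE => x y /=; rewrite !adjointP. Qed.

Lemma adjoint_sub S T : bounded_operator S -> bounded_operator T ->
  adjoint (S \- T) = adjoint S \- adjoint T.
Proof.
move=> bS bT; apply: adjointE => x y /=.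
by rewrite linearBl linearBr /= !adjointP.
Qed.

Lemma adjoint_id : adjoint (idfun : H -> H) = idfun.
Proof. exact: adjointE. Qed.

Lemma bounded_id : bounded_operator (idfun : H -> H).
Proof. by split=> //; exists 1 => x; rewrite mul1r. Qed.

Lemma bounded_comp S T :
  bounded_operator S -> bounded_operator T -> bounded_operator (S \o T).
Proof.
move=> [Sl [C SC]] [Tl [D TD]]; split=> [a x y|] /=; first by rewrite Tl Sl.
exists (`|C| * D) => x; apply: le_trans (SC _) _.
rewrite rmorphM -mulrA; apply: (@le_trans _ _ (`|C|%:C * `|T x|)).
  by rewrite ler_wpM2r // lecR ler_norm.
by rewrite ler_wpM2l // lecR.
Qed.

Lemma bounded_sub S T :
  bounded_operator S -> bounded_operator T -> bounded_operator (S \- T).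
Proof.
move=> [Sl [C SC]] [Tl [D TD]]; split=> [a x y|] /=.
  by rewrite Tl Sl scalerBr opprD addrACA.
exists (C + D) => x; apply: le_trans (ler_normB _ _) _.
by rewrite rmorphD mulrDl lerD.
Qed.

(** The last clause recognises the projection as an element of a commutant: when
    [T] and its adjoint both preserve [K], then [T] also preserves the orthogonal
    complement of [K], so it commutes with the projection onto [K]. *)
Lemma exists_projection_operator (K : set H) : subspace K -> closed K ->
  exists P : H -> H, [/\ bounded_operator P, forall x, K (P x),
    forall x, K x -> P x = x
    & forall S T, linear T -> is_adjoint T S ->
        (forall x, K x -> K (T x)) -> (forall x, K x -> K (S x)) ->
        T \o P = P \o T].
Proof.
move=> sK cK; have [K0 KZ] := sK.
have KB x y : K x -> K y -> K (x - y).
  by move=> Kx Ky; rewrite -scaleN1r addrC; apply: KZ.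
have /choice [P PP] : forall x, exists y, K y /\ forall z, K z -> '[x - y, z] = 0.
  by move=> x; have [y] := exists_orthogonal_projection x sK cK; exists y.
have KP x : K (P x) by case: (PP x).
have Porth x z : K z -> '[x - P x, z] = 0 by case: (PP x) => _; apply.
have Puniq x y : K y -> (forall z, K z -> '[x - y, z] = 0) -> P x = y.
  move=> Ky yorth; apply/eqP; rewrite -subr_eq0 -dot_eq0.
  have {1}-> : P x - y = (x - y) - (x - P x).
    by rewrite opprB [RHS]addrC addrA subrK.
  by rewrite linearBl /= Porth ?yorth ?subrr //; apply: KB.
exists P; split=> //.
- split=> [a x y|].
    apply: Puniq; first exact: KZ.
    move=> z Kz; rewrite opprD addrACA -scalerBr linearPl /=.
    by rewrite !Porth // mulr0 addr0.
  exists 1 => x; rewrite mul1r.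
  have [->|Px0] := eqVneq (P x) 0; first by rewrite normr0.
  rewrite -(@ler_pM2r _ `|P x|) ?normr_gt0 // -expr2 dotH_norm.
  have xPx : '[P x, P x] = '[x, P x].
    by apply/esym/eqP; rewrite -subr_eq0 -linearBl /= Porth.
  rewrite xPx; apply: le_trans (cauchy_schwarz _ _); apply: real_ler_norm.
  by rewrite -xPx -dotH_norm realX // normr_real.
- by move=> x Kx; apply: Puniq => // z _; rewrite subrr linear0l.
move=> S T Tl TS KT KS; apply/funext => x /=; symmetry.
apply: Puniq; first exact: KT.
by move=> z Kz; rewrite -linB // TS; apply: Porth; apply: KS.
Qed.

End HilbertSpace.

(** * Von Neumann algebras and factors *)

Section VonNeumannAlgebras.
Variables (R : realType) (H : hilbertType R).
Implicit Types (M N S : set (H -> H)) (T a b p q t u v : H -> H).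

Local Notation one := (idfun : H -> H).
Local Notation zero := ((fun=> 0) : H -> H).

Lemma commutant_id S : commutant S one.
Proof. by split=> //; apply: bounded_id. Qed.

Lemma commutant_comp S T T' :
  commutant S T -> commutant S T' -> commutant S (T \o T').
Proof.
move=> [bT cT] [bT' cT']; split; first exact: bounded_comp.
move=> s Ss; apply/funext => x /=.
have /(congr1 (@^~ x)) /= -> := cT' s Ss.
by have /(congr1 (@^~ (T' x))) /= -> := cT s Ss.
Qed.

Lemma commutant_sub S T T' : (forall s, S s -> bounded_operator s) ->
  commutant S T -> commutant S T' -> commutant S (T \- T').
Proof.
move=> bS [bT cT] [bT' cT']; split; first exact: bounded_sub.
move=> s Ss; apply/funext => x /=; rewrite (linB (bS s Ss).1).
have /(congr1 (@^~ x)) /= -> := cT s Ss.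
by have /(congr1 (@^~ x)) /= -> := cT' s Ss.
Qed.

Lemma commutant_adjoint S T : (forall s, S s -> bounded_operator s) ->
  (forall s, S s -> S (adjoint s)) -> commutant S T -> commutant S (adjoint T).
Proof.
move=> bS aS [bT cT]; split=> [|s Ss]; first exact: bounded_adjoint.
have bs := bS s Ss; have bs' := bounded_adjoint bs.
have /(congr1 (@adjoint R H)) := cT _ (aS s Ss).
by rewrite (adjoint_comp bT bs') (adjoint_comp bs' bT) adjointK.
Qed.

Section Closure.
Variable M : set (H -> H).
Hypothesis vnM : von_neumann M.

Let bicommutantE : commutant (commutant M) = M. Proof. by case: vnM. Qed.

Lemma vn_bounded T : M T -> bounded_operator T.
Proof. by rewrite -bicommutantE => -[]. Qed.

Lemma vn_adjoint T : M T -> M (adjoint T).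
Proof. by case: vnM => + _; apply. Qed.

Lemma vn_id : M one.
Proof. by rewrite -bicommutantE; apply: commutant_id. Qed.

Lemma vn_comp T T' : M T -> M T' -> M (T \o T').
Proof. by rewrite -bicommutantE; apply: commutant_comp. Qed.

Lemma vn_sub T T' : M T -> M T' -> M (T \- T').
Proof. by rewrite -bicommutantE; apply: commutant_sub => s []. Qed.

Lemma vn_opp T : M T -> M (zero \- T).
Proof.
move=> MT; apply: vn_sub => //.
have -> : zero = one \- one by apply/funext => x /=; rewrite subrr.
by apply: vn_sub; apply: vn_id.
Qed.

Lemma vn_add T T' : M T -> M T' -> M (T \+ T').
Proof.
move=> MT MT'; have -> : T \+ T' = T \- (zero \- T').
  by apply/funext => x /=; rewrite sub0r opprK.
by apply: vn_sub => //; apply: vn_opp.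
Qed.

Lemma vn_adjointK T : M T -> adjoint (adjoint T) = T.
Proof. by move=> /vn_bounded/adjointK. Qed.

Lemma vn_adjoint_comp T T' : M T -> M T' ->
  adjoint (T \o T') = adjoint T' \o adjoint T.
Proof. by move=> /vn_bounded bT /vn_bounded; apply: adjoint_comp. Qed.

End Closure.

(** A factor is a prime ring.  The subspace of all [y] killed by every [a x],
    [x] in [M], is invariant under both [M] and its commutant, so its projection
    is central, that is [0] or [1]; in the first case [b], which maps into that
    subspace, vanishes, and in the second [a] does. *)
Lemma factor_prime M a b : Defs.factor M -> M a -> M b ->
  (forall x, M x -> a \o x \o b = zero) -> a = zero \/ b = zero.
Proof.
move=> [vnM one0 centerM] Ma Mb ab0.
have Ml T : M T -> linear T by move=> /(vn_bounded vnM)[].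
pose K := [set y : H | forall x, M x -> (a \o x) y = 0].
have sK : subspace K.
  split=> [x Mx|c y z Ky Kz x Mx]; first exact: (lin0 (Ml _ (vn_comp vnM Ma Mx))).
  by rewrite (Ml _ (vn_comp vnM Ma Mx)) Ky // Kz // scaler0 addr0.
have cK : closed K.
  have -> : K = \bigcap_(x in M) [set y | (a \o x) y = 0].
    by apply/seteqP; split.
  apply: closed_bigI => x Mx.
  have [axl [C axC]] := vn_bounded vnM (vn_comp vnM Ma Mx).
  exact: closed_kernel axl _ axC.
have [P [bP KP Pid Pcomm]] := exists_projection_operator sK cK.
have MK T : M T -> forall y, K y -> K (T y).
  by move=> MT y Ky x Mx; apply: (Ky (x \o T)); apply: vn_comp.
have cMK T : commutant M T -> forall y, K y -> K (T y).
  move=> [[Tl _] cT] y Ky x Mx.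
  have /(congr1 (@^~ y)) /= <- := cT _ (vn_comp vnM Ma Mx).
  by rewrite -[a (x y)]/((a \o x) y) Ky // lin0.
have : Defs.center M P.
  split.
    case: (vnM) => _ <-; split=> // T cT.
    apply/esym/(Pcomm (adjoint T)); last 2 first.
    - exact: cMK.
    - apply/cMK/commutant_adjoint => //; [exact: vn_bounded | exact: vn_adjoint].
    - by case: cT => -[].
    - by apply: adjointP; case: cT.
  split=> // T MT.
  apply/esym/(Pcomm (adjoint T)); last 2 first.
  - exact: MK.
  - exact: MK (vn_adjoint vnM MT).
  - exact: Ml.
  - by apply: adjointP; apply: (vn_bounded vnM).
rewrite centerM => -[c Pc].
have [c0|c0] := eqVneq c 0; [right|left]; apply/funext => y /=.
  rewrite -(Pid (b y)); first by rewrite Pc c0 scale0r.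
  by move=> x Mx; have /(congr1 (@^~ y)) := ab0 x Mx.
have := KP (c^-1 *: y); rewrite Pc scalerA divff // scale1r.
by move=> /(_ _ (vn_id vnM)).
Qed.

Lemma projection_compl M p : von_neumann M -> projection_in M p ->
  projection_in M (one \- p).
Proof.
move=> vnM [Mp pp ap]; have bp := vn_bounded vnM Mp; split.
- exact: vn_sub (vn_id vnM) Mp.
- apply/funext => x /=; rewrite (linB bp.1).
  by have /(congr1 (@^~ x)) /= -> := pp; rewrite subrr subr0.
- by rewrite adjoint_sub ?adjoint_id ?ap //; apply: bounded_id.
Qed.

(** A partial isometry kills the complement of its initial projection [p], since
    [|v (x - p x)|^2 = '[x - p x, p (x - p x)] = 0]. *)
Lemma partial_isometry_comp M v p : von_neumann M -> M v ->
  p \o p = p -> adjoint v \o v = p -> v \o p = v.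
Proof.
move=> vnM Mv pp vv; have bv := vn_bounded vnM Mv; apply/funext => x /=.
apply/esym/eqP; rewrite -subr_eq0 -(linB bv.1) -dot_eq0 (adjointP bv).
have -> : adjoint v (v (x - p x)) = p x - p (p x).
  have vvE y : adjoint v (v y) = p y := congr1 (@^~ y) vv.
  by rewrite (linB bv.1) (linB (bounded_adjoint bv).1) !vvE.
have ppx : p (p x) = p x := congr1 (@^~ x) pp.
by rewrite ppx subrr linear0r.
Qed.

(** * Finite projections and exchange with the complement *)

(** A partial isometry [v] from [p] to a subprojection of [p] lies in the
    commutative algebra [p M p], so it commutes with its adjoint, and its initial
    and final projections agree. *)
Lemma abelian_projection_finite M p : von_neumann M ->
  abelian_projection M p -> finite_projection M p.
Proof.
move=> vnM [[Mp pp ap] comm]; split=> // q [Mq qq aq] qp [v [Mv vv vv']].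
have Mv' := vn_adjoint vnM Mv.
have vp : v \o p = v := partial_isometry_comp vnM Mv pp vv.
have v'q : adjoint v \o q = adjoint v.
  by apply: (partial_isometry_comp vnM Mv' qq); rewrite (vn_adjointK vnM).
have qv : q \o v = v.
  rewrite -{2}(vn_adjointK vnM Mv) -v'q (vn_adjoint_comp vnM) // aq.
  by rewrite (vn_adjointK vnM).
have pv : p \o v = v by rewrite -qv compA qp.
have pvp : p \o v \o p = v by rewrite pv.
have pv'p : p \o adjoint v \o p = adjoint v.
  have Mpv : M (p \o v) := vn_comp vnM Mp Mv.
  rewrite -[in RHS]pvp (vn_adjoint_comp vnM Mpv Mp).
  by rewrite (vn_adjoint_comp vnM Mp Mv) ap.
by have := comm v (adjoint v) Mv Mv'; rewrite pvp pv'p vv vv'.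
Qed.

(** If the space of [p] contains an isometric copy [t] of the whole space, then
    compressing [t] to [p] gives an equivalence of [p] with [t p t^*], which is
    below [p]; finiteness forces [p = t p t^*], and then [p] is everything. *)
Lemma finite_projection_isometry M p t : von_neumann M ->
  finite_projection M p -> M t -> adjoint t \o t = one -> p \o t = t -> p = one.
Proof.
move=> vnM [[Mp pp ap] fin] Mt tt pt.
have Mt' := vn_adjoint vnM Mt.
have ptx x : p (t x) = t x := congr1 (@^~ x) pt.
have ttx x : adjoint t (t x) = x := congr1 (@^~ x) tt.
have ppx x : p (p x) = p x := congr1 (@^~ x) pp.
have Mtp : M (t \o p) by apply: vn_comp.
have atp : adjoint (t \o p) = p \o adjoint t by rewrite (vn_adjoint_comp vnM) // ap.
have pE : t \o p \o adjoint t = p.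
  apply: fin.
  - split; first exact: vn_comp.
      by apply/funext => x /=; rewrite ttx ppx.
    by rewrite (vn_adjoint_comp vnM) // atp (vn_adjointK vnM).
  - by apply/funext => x /=; rewrite ptx.
  - exists (t \o p); rewrite atp; split=> //; apply/funext => x /=.
      by rewrite ttx ppx.
    by rewrite ppx.
apply/funext => x /=; rewrite -(ttx (p x)).
have -> : t (p x) = p (t x).
  by rewrite -[RHS](congr1 (@^~ (t x)) pE) /= ttx.
by rewrite ptx ttx.
Qed.

Lemma projection_conj M v p : von_neumann M -> M v -> adjoint v \o v = one ->
  projection_in M p -> projection_in M (v \o p \o adjoint v).
Proof.
move=> vnM Mv vv [Mp pp ap]; have Mv' := vn_adjoint vnM Mv.
have Mvp := vn_comp vnM Mv Mp.
split; first exact: vn_comp.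
  apply/funext => x /=.
  have -> : adjoint v (v (p (adjoint v x))) = p (adjoint v x).
    exact: (congr1 (@^~ (p (adjoint v x))) vv).
  by have /= -> := congr1 (@^~ (adjoint v x)) pp.
by rewrite (vn_adjoint_comp vnM Mvp Mv') (vn_adjoint_comp vnM Mv Mp) ap
           (vn_adjointK vnM Mv).
Qed.

(** Let [v] be a non-unitary isometry and [e] the projection [1 - v v^*].  If some
    unitary exchanges [e] with its complement [v v^*], then [e] is the range of
    an isometry, and a finite projection moved below [v v^*] by [v] will do: a
    unitary exchanging it with its complement would embed [e], hence the
    identity, into a finite projection. *)
Lemma exists_unexchangeable_projection M p0 : von_neumann M ->
  one <> zero -> finite_projection M p0 -> nonzero p0 ->
  ~ finite_projection M one ->
  exists p, [/\ projection_in M p, p <> zero, p <> one &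
    forall u, M u -> adjoint u \o u = one -> u \o adjoint u = one ->
      u \o p \o adjoint u <> one \- p].
Proof.
move=> vnM one0 finp0 p0n0 infM.
have Mone := vn_id vnM.
have [v [Mv vv vv1]] : exists v,
    [/\ M v, adjoint v \o v = one & v \o adjoint v <> one].
  apply: contra_notP infM => noiso; split.
    by split=> //; rewrite adjoint_id.
  move=> q _ _ [v [Mv vv vq]]; apply: contra_notP noiso => q1.
  by exists v; rewrite vq.
have Mv' := vn_adjoint vnM Mv.
have vvx x : adjoint v (v x) = x := congr1 (@^~ x) vv.
have vl := (vn_bounded vnM Mv).1; have v'l := (vn_bounded vnM Mv').1.
have pr_vv : projection_in M (v \o adjoint v).
  split; first exact: vn_comp.
    by apply/funext => x /=; rewrite vvx.
  by rewrite (vn_adjoint_comp vnM) // (vn_adjointK vnM).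
set e := one \- (v \o adjoint v).
have pre : projection_in M e by apply: projection_compl.
have eE x : e x = x - v (adjoint v x) by [].
have v'e x : adjoint v (e x) = 0 by rewrite eE (linB v'l) vvx subrr.
have [exch|noexch] := pselect (exists u, [/\ M u, adjoint u \o u = one,
    u \o adjoint u = one & u \o e \o adjoint u = one \- e]); last first.
  exists e; split=> //.
  - by move=> e0; apply: vv1; apply/funext => x; have := eE x;
       rewrite e0 => /esym/eqP; rewrite subr_eq0 => /eqP.
  - move=> e1; apply: one0; apply/funext => x /=.
    by rewrite -(vvx x) -[v x]/(one (v x)) -e1 v'e.
  - by move=> u Mu uu uu' ueu; apply: noexch; exists u.
have [u [Mu uu uu' ueu]] := exch.
have Mu' := vn_adjoint vnM Mu.
have uux x : adjoint u (u x) = x := congr1 (@^~ x) uu.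
have uux' x : u (adjoint u x) = x := congr1 (@^~ x) uu'.
have ueux x : u (e (adjoint u x)) = v (adjoint v x).
  by rewrite [LHS](congr1 (@^~ x) ueu) /= /e /= opprB addrC subrK.
have [[Mp0 pp0 ap0] _] := finp0.
have pp0x x : p0 (p0 x) = p0 x := congr1 (@^~ x) pp0.
have p0l := (vn_bounded vnM Mp0).1.
pose p := v \o p0 \o adjoint v.
have pE x : p x = v (p0 (adjoint v x)) by [].
have prp : projection_in M p by apply: projection_conj; case: finp0.
exists p; split=> //.
- move=> p_0; apply: p0n0; apply/funext => x.
  by rewrite -(vvx (p0 x)) -{1}(vvx x) -pE p_0 (lin0 v'l).
- move=> p_1; apply: vv1; apply/funext => x /=.
  by rewrite -[x in RHS]/(one x) -p_1 pE -{1}[x]/(one x) -p_1 pE vvx.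
move=> u2 Mu2 uu2 uu2' upu2.
have Mu2' := vn_adjoint vnM Mu2.
have uu2x x : adjoint u2 (u2 x) = x := congr1 (@^~ x) uu2.
have uu2x' x : u2 (adjoint u2 x) = x := congr1 (@^~ x) uu2'.
have upu2x x : u2 (p (adjoint u2 x)) = x - p x := congr1 (@^~ x) upu2.
(* [w] is the isometry with range [e]. *)
pose w := adjoint u \o v.
have ew x : e (w x) = w x.
  by rewrite -(uux (e (w x))) /w /= ueux vvx.
have pw x : adjoint u2 (w x) = p (adjoint u2 (w x)).
  rewrite -[RHS]uu2x upu2x -[in X in _ - X]ew pE v'e (lin0 p0l) (lin0 vl).
  by rewrite subr0.
have Mw : M w by apply: vn_comp.
pose t := adjoint v \o (adjoint u2 \o w).
have Mt : M t by do 2?[apply: vn_comp => //].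
apply: infM; suff <- : p0 = one by [].
apply: (finite_projection_isometry vnM finp0 Mt).
  rewrite /t (vn_adjoint_comp vnM Mv' (vn_comp vnM Mu2' Mw)).
  rewrite (vn_adjoint_comp vnM Mu2' Mw) (vn_adjoint_comp vnM Mu' Mv).
  rewrite !(vn_adjointK vnM) //; apply/funext => x.
  rewrite /= pw pE vvx -pE -pw uu2x'.
  by rewrite /w /= uux' vvx.
apply/funext => x; rewrite -[LHS]/(p0 (t x)).
by rewrite -[t x]/(adjoint v (adjoint u2 (w x))) pw pE vvx pp0x.
Qed.

(** * The block-diagonal subalgebra *)

(** The block-diagonal part of [M] with respect to [p], that is
    [p M p + (1 - p) M (1 - p)] when [p] is a projection of [M]. *)
Definition block_diagonal M p : set (H -> H) :=
  [set T | M T /\ T \o p = p \o T].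

Section BlockDiagonal.
Variables (M : set (H -> H)) (p : H -> H).
Hypotheses (vnM : von_neumann M) (prp : projection_in M p).

Let Mp : M p. Proof. by case: prp. Qed.
Let ap : adjoint p = p. Proof. by case: prp. Qed.
Let ppx x : p (p x) = p x.
Proof. by case: prp => _ pp _; exact: (congr1 (@^~ x) pp). Qed.
Let pl : linear p. Proof. by case: (vn_bounded vnM Mp). Qed.

Lemma von_neumann_block_diagonal : von_neumann (block_diagonal M p).
Proof.
split=> [T [MT Tp]|].
  split; first exact: vn_adjoint.
  have := congr1 (@adjoint R H) Tp.
  by rewrite (vn_adjoint_comp vnM MT Mp) (vn_adjoint_comp vnM Mp MT) ap.
apply/seteqP; split=> [T [bT cT]|T [MT Tp]].
  split.
    case: (vnM) => _ <-; split=> // S [bS cS].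
    by apply: cT; split=> // s [Ms _]; apply: cS.
  by apply: cT; split=> [|s [_ sp]] //; apply: vn_bounded Mp.
split=> [|S [bS cS]]; first exact: vn_bounded MT.
by apply/esym/cS.
Qed.

(** Here [n] has its range and its support each inside [p] or inside [1 - p], so
    conjugation by [n] or by its adjoint carries all of [M] into a single diagonal
    block. *)
Lemma normaliser_block n : M n -> p \o n = n \/ p \o n = zero ->
  n \o p = n \/ n \o p = zero -> normaliser M (block_diagonal M p) n.
Proof.
move=> Mn pn np; have Mn' := vn_adjoint vnM Mn.
have az : adjoint zero = zero :> (H -> H).
  by apply: adjointE => x y; rewrite linear0l linear0r.
have conj m c : M m -> M c -> p \o m = m \/ p \o m = zero ->
    block_diagonal M p (m \o c \o adjoint m).
  move=> Mm Mc pm; have Mm' := vn_adjoint vnM Mm.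
  split; first by do 2?[apply: vn_comp => //].
  have m'p : adjoint m \o p = adjoint (p \o m).
    by rewrite (vn_adjoint_comp vnM) ?ap.
  apply/funext => x; have /= -> := congr1 (@^~ x) m'p.
  case: pm => pm; have /= pmx y := congr1 (@^~ y) pm; rewrite pm pmx //.
  by rewrite az (lin0 (vn_bounded vnM Mc).1) (lin0 (vn_bounded vnM Mm).1).
split=> // c [Mc _]; split; first exact: conj.
rewrite -{2}(vn_adjointK vnM Mn); apply: conj => //.
have -> : p \o adjoint n = adjoint (n \o p) by rewrite (vn_adjoint_comp vnM) ?ap.
by case: np => ->; [left | right].
Qed.

Lemma regular_block_diagonal : regular M (block_diagonal M p).
Proof.
have sub : block_diagonal M p `<=` M by move=> T [].
apply/seteqP; split=> [T|T MT N vnN NM normN].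
  by apply=> // n [].
pose q := one \- p.
have [Mq _ _] : projection_in M q by apply: projection_compl.
have Tl := (vn_bounded vnM MT).1.
have -> : T = ((p \o T \o p) \+ (p \o T \o q)) \+
              ((q \o T \o p) \+ (q \o T \o q)).
  have pqE x : p x + q x = x by rewrite addrC subrK.
  by apply/funext => x; rewrite /GRing.add_fun /comp addrACA !pqE -(linD Tl) pqE.
have corner a b : M a -> M b ->
    (forall x, p (a x) = a x) \/ (forall x, p (a x) = 0) ->
    (forall x, b (p x) = b x) \/ (forall x, b (p x) = 0) -> N (a \o T \o b).
  move=> Ma Mb pa bp; apply: normN; apply: normaliser_block.
  - by do 2?[apply: vn_comp => //].
  - by case: pa => pa; [left|right]; apply/funext => x /=; rewrite pa.
  - case: bp => bp; [left|right]; apply/funext => x /=; rewrite bp //.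
    by rewrite (lin0 Tl) (lin0 (vn_bounded vnM Ma).1).
have pq x : p (q x) = 0 by rewrite /q /= (linB pl) ppx subrr.
have qp x : q (p x) = 0 by rewrite /q /= ppx subrr.
apply: vn_add => //; apply: vn_add => //; apply: corner => //.
all: try by [left | right].
Qed.

(** Since [p x p] is in the block-diagonal algebra, it commutes with [q], whence
    [q p x (p - q p) = 0] for all [x] in [M], and a factor is prime. *)
Lemma commuting_block_trivial q : Defs.factor M -> projection_in M q ->
  (forall T, block_diagonal M p T -> T \o q = q \o T) ->
  q \o p = zero \/ q \o p = p.
Proof.
move=> facM [Mq qq aq] comm.
have qqx x : q (q x) = q x := congr1 (@^~ x) qq.
have ql := (vn_bounded vnM Mq).1.
have Mqp : M (q \o p) by apply: vn_comp.
have [] := factor_prime facM Mqp (vn_sub vnM Mp Mqp).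
- move=> x Mx; have bx : block_diagonal M p (p \o x \o p).
    split; first by do 2?[apply: vn_comp => //].
    by apply/funext => y /=; rewrite !ppx.
  have pxpq y : p (x (p (q y))) = q (p (x (p y))) := congr1 (@^~ y) (comm _ bx).
  have pq y : p (q y) = q (p y).
    by apply: (congr1 (@^~ y) (comm p _)); split.
  apply/funext => y /=.
  have -> : p y - q (p y) = p (y - q y) by rewrite (linB pl) pq.
  by rewrite -pxpq (linB ql) qqx subrr !lin0 //; case/(vn_bounded vnM): Mx.
- by left.
- move=> h; right; apply/funext => x; apply/esym/eqP; rewrite -subr_eq0.
  by have /= -> := congr1 (@^~ x) h.
Qed.

End BlockDiagonal.

Lemma block_diagonal_compl M p : von_neumann M ->
  block_diagonal M (one \- p) `<=` block_diagonal M p.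
Proof.
move=> vnM T [MT Tq]; split=> //; apply/funext => x /=.
have := congr1 (@^~ x) Tq; rewrite /= (linB (vn_bounded vnM MT).1).
by move/(congr1 (fun y => T x - y)); rewrite !subKr.
Qed.

(** Unitary normalisers of the block-diagonal algebra permute the minimal
    central projections [p] and [1 - p] of that algebra; when no unitary
    exchanges these, they fix [p], so they lie in the block-diagonal algebra
    itself. *)
Lemma unitary_normaliser_block_diagonal M p : Defs.factor M ->
  projection_in M p -> p <> zero -> p <> one ->
  (forall u, M u -> adjoint u \o u = one -> u \o adjoint u = one ->
      u \o p \o adjoint u <> one \- p) ->
  unitary_normaliser M (block_diagonal M p) `<=` block_diagonal M p.
Proof.
move=> facM prp p0 p1 noexch u [Mu uu uu' uB]; have [vnM _ _] := facM.
have Mu' := vn_adjoint vnM Mu; have [Mp pp ap] := prp.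
have uux x : adjoint u (u x) = x := congr1 (@^~ x) uu.
have uux' x : u (adjoint u x) = x := congr1 (@^~ x) uu'.
have ppx x : p (p x) = p x := congr1 (@^~ x) pp.
have ul := (vn_bounded vnM Mu).1; have pl := (vn_bounded vnM Mp).1.
pose q := u \o p \o adjoint u.
have qE x : q x = u (p (adjoint u x)) by [].
have ql : linear q.
  by case: (vn_bounded vnM (vn_comp vnM (vn_comp vnM Mu Mp) Mu')).
have prq : projection_in M q by apply: projection_conj.
have comm T : block_diagonal M p T -> T \o q = q \o T.
  rewrite -uB => -[S [MS Sp] <-]; apply/funext => x; rewrite /= !qE !uux.
  by have /= -> := congr1 (@^~ (adjoint u x)) Sp.
have prp' := projection_compl vnM prp.
have comm' T : block_diagonal M (one \- p) T -> T \o q = q \o T.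
  by move=> /block_diagonal_compl BT; apply/comm/BT.
have upq x : u (p x) = q (u x) by rewrite qE uux.
have qp := commuting_block_trivial vnM prp facM prq comm.
have qp' := commuting_block_trivial vnM prp' facM prq comm'.
have qsplit x : q x = q (p x) + q (x - p x) by rewrite -(linD ql) addrC subrK.
have [{}qp|{}qp] := qp; have [{}qp'|{}qp'] := qp'.
- (* q = 0 *)
  case: p0; apply/funext => x; rewrite -(uux (p x)) upq qsplit.
  have /= -> := congr1 (@^~ (u x)) qp; have /= -> := congr1 (@^~ (u x)) qp'.
  by rewrite addr0 (lin0 (vn_bounded vnM Mu').1).
- (* q = 1 - p *)
  case: (noexch u Mu uu uu'); apply/funext => x; rewrite -/q qsplit.
  have /= -> := congr1 (@^~ x) qp; have /= -> := congr1 (@^~ x) qp'.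
  by rewrite add0r.
- (* q = p *)
  split=> //; apply/funext => x; rewrite /= upq qsplit.
  have /= -> := congr1 (@^~ (u x)) qp; have /= -> := congr1 (@^~ (u x)) qp'.
  by rewrite addr0.
- (* q = 1 *)
  case: p1; apply/funext => x; rewrite -(uux (p x)) upq qsplit.
  have /= -> := congr1 (@^~ (u x)) qp; have /= -> := congr1 (@^~ (u x)) qp'.
  by rewrite addrC subrK uux.
Qed.

Lemma block_diagonal_neq M p : Defs.factor M -> projection_in M p ->
  p <> zero -> p <> one -> block_diagonal M p <> M.
Proof.
move=> [vnM _ centerM] [Mp pp _] p0 p1 BM.
have : Defs.center M p.
  split=> //; split=> [|T]; first exact: vn_bounded Mp.
  by rewrite -{1}BM => -[].
rewrite centerM => -[c pc].
have [c0|c0] := eqVneq c 0.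
  by apply: p0; apply/funext => x; rewrite pc c0 scale0r.
apply: p1; apply/funext => x /=; apply: (scalerI c0).
by have := congr1 (@^~ x) pp; rewrite pc.
Qed.

Lemma central_id M : Defs.factor M -> central_projection M one /\ nonzero one.
Proof.
move=> [vnM one0 centerM]; split=> //; split.
  by split=> //; [apply: vn_id | apply: adjoint_id].
by rewrite centerM; exists 1; apply/funext => x; rewrite scale1r.
Qed.

End VonNeumannAlgebras.

Theorem theorem3p9 (R : realType) (H : hilbertType R) (M : set (H -> H))
    (hM : type_I_infty_factor M \/ type_II_infty_factor M) :
  exists B : set (H -> H),
    [/\ von_neumann B, B `<=` M, regular M B & ~ unitarily_regular M B].
Proof.
have [facM infM finM] : [/\ Defs.factor M, properly_infinite M &
    exists2 p, finite_projection M p & nonzero p].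
  case: hM => -[facM typeM inf]; split=> //; have [vnM one0 _] := facM;
    have [c1 n1] := central_id facM.
    have [p [abp np _]] := typeM _ c1 n1.
    by exists p => //; apply: abelian_projection_finite.
  by have [_ /(_ _ c1 n1) [p [fp np _]]] := typeM; exists p.
have [vnM one0 _] := facM; have [p0 finp0 p0n0] := finM.
have [c1 n1] := central_id facM.
have [p [prp pn0 pn1 noexch]] :=
  exists_unexchangeable_projection vnM one0 finp0 p0n0 (infM _ c1 n1).
have vnB := von_neumann_block_diagonal vnM prp.
exists (block_diagonal M p); split.
- exact: vnB.
- by move=> T [].
- exact: regular_block_diagonal vnM prp.
move=> uregB; apply: (block_diagonal_neq facM prp pn0 pn1).
apply/seteqP; split=> [T []//|T].
rewrite -{1}uregB; apply=> //; first by move=> S [].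
exact: unitary_normaliser_block_diagonal.
Qed.
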